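(* Let $\alpha \in (0,1)$ and let $c_\alpha$ be such that $\mathbb P(\tau_n \leq c_\alpha \mid \mathcal H_0) = \alpha$. Then the test $\Phi = \mathds{1}\{\tau_n \leq c_\alpha\}$ is the most powerful scale-free test of level $\alpha$ to test $\mathcal H_0$ against $\mathcal H_1$. That is, $\Phi$ is a scale-free test of level $\alpha$, and for every scale-free test $\Phi'$ with $\mathbb P(\Phi'(X)=1 \mid \mathcal H_0) \leq \alpha$ one has $\mathbb P(\Phi'(X)=1 \mid \mathcal H_1) \leq \mathbb P(\Phi(X)=1 \mid \mathcal H_1)$.
   Context: $X=(X_1,\dots,X_n)$ is a sample of independent identically distributed random variables with values in $[0,+\infty)$. The null hypothesis $\mathcal H_0$ is that the $X_i$'s are uniformly distributed on an interval $[0,\theta]$ for some (unknown) $\theta>0$. The alternative $\mathcal H_1$ is that the $X_i$'s are exponentially distributed with some (unknown) parameter $\lambda>0$. Here $\mathds{1}\{\cdot\}$ is the indicator function. The mean/max statistic is $\tau_n = \overline X_n / X_{(n)}$, where $X_{(n)} = \max\{X_1,\dots,X_n\}$ and $\overline X_n = \frac1n\sum_{i=1}^n X_i$ (defined almost surely under both hypotheses). A test is a measurable binary-valued function $\Phi=\Phi(X)\in\{0,1\}$ of the sample, where $\Phi(X)=1$ means that $\mathcal H_0$ is rejected. A test is scale-free if $\Phi(X)=\Phi(tX)$ for all $t>0$. Because the uniform and the exponential models are both stable under multiplication by positive constants, the distribution of a scale-free statistic under $\mathcal H_0$ does not depend on $\theta$, and under $\mathcal H_1$ does not depend on $\lambda$;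 hence the probabilities $\mathbb P(\cdot \mid \mathcal H_0)$ and $\mathbb P(\cdot\mid\mathcal H_1)$ of events determined by scale-free statistics are well defined. The level of a scale-free test is its rejection probability under $\mathcal H_0$ and its power is its rejection probability under $\mathcal H_1$. *)

(* Defs.v *)
From HB Require Import structures.
From mathcomp Require Import all_boot all_order all_algebra.
From mathcomp Require Import all_classical all_reals all_analysis.

Set Implicit Arguments.
Unset Strict Implicit.
Unset Printing Implicit Defensive.

Import Order.TTheory GRing.Theory Num.Theory.

Local Open Scope classical_set_scope.
Local Open Scope ring_scope.

Section samples.
Context {R : realType} {n : nat}.

Definition nonneg_samples : set (n.-tuple R) :=
  [set x | forall i, 0 <= tnth x i].

Definition scale_sample (t : R) (x : n.-tuple R) : n.-tuple R :=
  [tuple t * tnth x i | i < n].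

Definition sample_mean (x : n.-tuple R) : R :=
  (\sum_(i < n) tnth x i) / n%:R.

(* Only used on nonnegative samples, for which the base value 0 is harmless. *)
Definition sample_max (x : n.-tuple R) : R :=
  \big[Num.max/0]_(i < n) tnth x i.

(* Division by zero gives 0 on the zero sample, which has probability 0 under
   both hypotheses. *)
Definition mean_max (x : n.-tuple R) : R := sample_mean x / sample_max x.

Definition mean_max_test (c : R) : n.-tuple R -> bool :=
  fun x => mean_max x <= c.

(* The sample space is [0, +oo[^n: the values of a test on other tuples are
   irrelevant and left unconstrained. *)
Definition is_test (Phi : n.-tuple R -> bool) : Prop :=
  measurable_fun nonneg_samples Phi.

Definition scale_free (Phi : n.-tuple R -> bool) : Prop :=
  forall (t : R) (x : n.-tuple R), 0 < t -> nonneg_samples x ->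
    Phi (scale_sample t x) = Phi x.

Definition scale_free_test (Phi : n.-tuple R -> bool) : Prop :=
  is_test Phi /\ scale_free Phi.

End samples.

Section model.
Context {R : realType} {n : nat} {d : measure_display} {T : measurableType d}.
Variable X : 'I_n -> {mfun T >-> R}.

Definition sample (w : T) : n.-tuple R := [tuple X i w | i < n].

Section fixed_probability.
Variable P : probability T R.

Definition mutually_independent : Prop :=
  forall (J : {set 'I_n}) (A : 'I_n -> set R),
    (forall i, i \in J -> measurable (A i)) ->
    P (\bigcap_(i in [set` J]) (X i @^-1` A i)) =
    (\prod_(i in J) P (X i @^-1` A i))%E.

Definition iid (law : set R -> \bar R) : Prop :=
  mutually_independent /\
  forall (i : 'I_n) (A : set R), measurable A -> distribution P (X i) A = law A.

Definition under_H0 : Prop :=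
  exists (theta : R) (theta_gt0 : 0 < theta), iid (uniform_prob theta_gt0).

Definition under_H1 : Prop :=
  exists2 lambda : R, 0 < lambda & iid (exponential_prob lambda).

Definition rejection_probability (Phi : n.-tuple R -> bool) : \bar R :=
  P [set w | Phi (sample w)].

End fixed_probability.
End model.

(* Main.v *)
Require Import Defs.
From HB Require Import structures.
From mathcomp Require Import all_boot all_order all_algebra.
From mathcomp Require Import all_classical all_reals all_analysis.
From mathcomp Require Import measurable_realfun.
From mathcomp Require Import ring.

(** For a sample with sum S and maximum M, the likelihood of the scale of the
    sample can be integrated out: on events that only depend on the sample up
    to scale, the exponential law has a density with respect to the uniform
    law, and this density is a nonincreasing function of the mean/max statistic
    tau = S / (n M) (it equals n! / (n tau)^n).  The test that rejects for
    small tau is therefore the Neyman-Pearson test on scale-free events.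

    The density is obtained without polar coordinates.  For fixed r > 0, an
    exponential sample restricted to the cube [0, theta/r]^n has an explicit
    product density with respect to a uniform sample on [0, theta] divided by r
    ([ge0_integral_iid_change], which rests on [expectation_prod] and on the
    uniqueness of finite measures on tuples given their values on boxes).  The
    cubes are glued together by inserting in the exponential integral the
    factor

      1 = (M / theta)^n * int_{0 < r <= theta/M} n r^(n-1) dr,

    that is, 1 as an integral over those r for which the sample lies in the
    cube [0, theta/r]^n.  Exchanging the integrals, changing variables from the
    exponential to the rescaled uniform sample, and exchanging back gives an
    integral over r for each uniform sample; a cone E does not see the rescaling
    by r, and the substitution r = M u turns this integral into
    [likelihood_ratio n lambda tau].  This is [exponential_probability_cone].
    The weight M^n is what makes the result depend on tau alone.

    The integrand of [likelihood_ratio] is nonincreasing in tau, and the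
    Neyman-Pearson comparison of the events where exactly one of the two tests
    rejects concludes.  Cones are taken inside {M > 0}, whose complement is
    null under both hypotheses.  That the level does not depend on theta is
    again [ge0_integral_iid_change], with constant weights. *)

Set Implicit Arguments.
Unset Strict Implicit.
Unset Printing Implicit Defensive.

Import Order.TTheory GRing.Theory Num.Theory.
Import numFieldNormedType.Exports.
Local Open Scope classical_set_scope.
Local Open Scope ring_scope.

(** * Measures with a density *)

(** The proofs that the density is measurable and nonnegative are arguments, so
    that the measure structure declared below can be inferred from the term. *)
Definition density_measure d (T : measurableType d) (R : realType)
    (m : {measure set T -> \bar R}) (g : T -> R)
    (mg : measurable_fun setT g) (g0 : forall x, 0 <= g x) (A : set T) : \bar R :=
  (\int[m]_(x in A) (g x)%:E)%E.

Section density_measure.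
Local Open Scope ereal_scope.
Context d (T : measurableType d) (R : realType).
Variables (m : {measure set T -> \bar R}) (g : T -> R).
Hypotheses (mg : measurable_fun setT g) (g0 : forall x, (0 <= g x)%R).
Local Notation dens := (density_measure m mg g0).

Let dens0 : dens set0 = 0.
Proof. exact: integral_set0. Qed.

Let dens_ge0 A : 0 <= dens A.
Proof. by apply: integral_ge0 => x _; rewrite lee_fin. Qed.

Let dens_sigma_additive : semi_sigma_additive dens.
Proof.
move=> F mF tF mUF; rewrite /density_measure; apply: cvg_toP.
  apply: ereal_nondecreasing_is_cvgn => k l kl.
  apply: lee_sum_nneg_natr => // i _ _.
  by apply: integral_ge0 => x _; rewrite lee_fin.
rewrite ge0_integral_bigcup//.
- by apply/measurable_EFinP; exact: measurable_funTS.
- by move=> x _; rewrite lee_fin.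
Qed.

HB.instance Definition _ := isMeasure.Build _ _ _ dens
  dens0 dens_ge0 dens_sigma_additive.

Import HBNNSimple.

Let integral_density_indic E : measurable E ->
  \int[dens]_x (\1_E x)%:E = \int[m]_x (\1_E x * g x)%:E.
Proof.
move=> mE; rewrite integral_indic// setIT.
rewrite [LHS](_ : _ = \int[m]_(x in E) (g x)%:E)// integral_mkcond.
apply: eq_integral => x _; rewrite patchE indicE.
by case: ifPn => _; rewrite ?mul1r ?mul0r.
Qed.

Let integral_density_nnsfun (f : {nnsfun T >-> R}) :
  \int[dens]_x (f x)%:E = \int[m]_x (f x * g x)%:E.
Proof.
under [LHS]eq_integral do rewrite fimfunE -fsumEFin//.
rewrite [LHS]ge0_integral_fsum//; last 2 first.
  - by move=> r; exact/measurable_EFinP/measurableT_comp.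
  - by move=> n x _; rewrite EFinM nnfun_muleindic_ge0.
under [RHS]eq_integral.
  move=> x xD; rewrite fimfunE EFinM -fsumEFin// muleC ge0_mule_fsumr; last first.
    by move=> r; rewrite EFinM nnfun_muleindic_ge0.
  over.
rewrite [RHS]ge0_integral_fsum//; last 2 first.
  - move=> r; rewrite -[X in measurable_fun _ X]/(EFin \o _).
    by apply/measurable_EFinP; apply: measurable_funM => //; exact/measurableT_comp.
  - by move=> n x _; rewrite mule_ge0 ?lee_fin// -lee_fin EFinM nnfun_muleindic_ge0.
apply: eq_fsbigr => r _.
rewrite integralZl_indic_nnsfun//= integral_density_indic//.
under [RHS]eq_integral do rewrite -EFinM mulrCA [(g _ * _)%R]mulrC.
have [r0|r0] := leP 0%R r; first rewrite -ge0_integralZl//.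
- by apply/measurable_EFinP; apply: measurable_funM.
- by move=> x _; rewrite lee_fin mulr_ge0.
- rewrite preimage_nnfun0// indic0 integral0_eq ?mule0.
    by rewrite integral0_eq// => x _; rewrite mul0r mulr0.
  by move=> x _; rewrite mul0r.
Qed.

(** True for indicators by definition of the measure, hence for simple functions
    by linearity, hence in general by monotone convergence. *)
Lemma ge0_integral_density (f : T -> \bar R) :
  measurable_fun setT f -> (forall x, 0 <= f x) ->
  \int[dens]_x f x = \int[m]_x (f x * (g x)%:E).
Proof.
move=> mf f0; pose f_ := nnsfun_approx measurableT mf.
transitivity (lim (\int[dens]_x (f_ n x)%:E @[n --> \oo])).
  rewrite -monotone_convergence//=.
  - apply: eq_integral => ? /[!inE] xD; apply/esym/cvg_lim => //=.
    exact: cvg_nnsfun_approx.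
  - by move=> n; exact/measurable_EFinP/measurable_funTS.
  - by move=> n ? _; rewrite lee_fin.
  - by move=> ? _ ? ? mn; rewrite lee_fin; exact/lefP/nd_nnsfun_approx.
under eq_fun do rewrite integral_density_nnsfun.
rewrite -monotone_convergence//=.
- apply: eq_integral => x /[!inE] xD; apply/cvg_lim => //=.
  under eq_fun do rewrite EFinM.
  by apply: cvgeZr => //; exact: cvg_nnsfun_approx.
- by move=> n; apply/measurable_EFinP; apply: measurable_funM.
- by move=> n ? _; rewrite lee_fin mulr_ge0.
- by move=> ? _ ? ? mn; rewrite lee_fin ler_wpM2r//; exact/lefP/nd_nnsfun_approx.
Qed.

End density_measure.

(** * Expectation of a product of independent factors *)

Section product_expectation.
Local Open Scope ereal_scope.
Context (R : realType) (n : nat) d (T : measurableType d).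
Variables (X : 'I_n -> {mfun T >-> R}) (P : probability T R).
Hypothesis indepX : mutually_independent X P.

Let integral_indicT A : measurable A -> \int[P]_w (\1_A w)%:E = P A.
Proof. by move=> mA; rewrite integral_indic// setIT. Qed.

Let expectation_prod_indic (A : 'I_n -> set R) :
  (forall i, measurable (A i)) ->
  \int[P]_w (\prod_i \1_(A i) (X i w))%:E = \prod_i P (X i @^-1` A i).
Proof.
move=> mA.
have mXA i : measurable (X i @^-1` A i).
  by rewrite -[_ @^-1` _]setTI; exact: measurable_funP.
have := indepX (J := [set: 'I_n]%SET) (fun i _ => mA i).
rewrite [RHS](_ : _ = \prod_i P (X i @^-1` A i)); last first.
  by apply: eq_bigl => i; rewrite inE.
move=> <-; rewrite -[in RHS]integral_indicT; last first.
  exact: fin_bigcap_measurable.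
apply: eq_integral => w _; congr EFin.
rewrite indicE; case: (boolP (w \in _)) => [|wA].
  rewrite inE => wA; rewrite big1// => i _.
  have wAi : A i (X i w) by apply: (wA i) => /=; rewrite inE.
  by rewrite indicE mem_set.
have [i wAi] : exists i, ~ A i (X i w).
  apply: contrapT => /forallNP h; move/negP: wA; apply.
  by rewrite inE => i _; apply: contrapT; exact: h.
by rewrite (bigD1 i)//= indicE memNset// mul0r.
Qed.

(** The factors are freed from being indicators one index at a time.  To free
    the factor of index k, the product Z of the other factors is used as a
    density: by the induction hypothesis, the law of X k under the measure Z P
    is a constant multiple C of its law under P, so that integrating any
    f k against it produces C times the expectation of f k. *)
Let expectation_prod_prefix (k : nat) (f : 'I_n -> R -> R) (e : 'I_n -> R) :
  (forall i, measurable_fun setT (f i)) ->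
  (forall i x, (0 <= f i x)%R) ->
  (forall i : 'I_n, (k <= i)%N -> exists2 A, measurable A & f i = \1_A) ->
  (forall i, \int[P]_w (f i (X i w))%:E = (e i)%:E) ->
  \int[P]_w (\prod_i f i (X i w))%:E = (\prod_i e i)%:E.
Proof.
elim: k f e => [|k IH] f e mf f0 find fe.
  have /choice[A hA] (i : 'I_n) : exists A, measurable A /\ f i = \1_A.
    by have [//|A mA fA] := find i; exists A.
  under eq_integral do under eq_bigr do rewrite (hA _).2.
  rewrite expectation_prod_indic; last by move=> i; exact: (hA i).1.
  rewrite -prodEFin; apply: eq_bigr => i _; rewrite -fe (hA i).2.
  rewrite -[LHS]integral_indicT//.
  by rewrite -[_ @^-1` _]setTI; apply: measurable_funP => //; exact: (hA i).1.
have [kn|nk] := ltnP k n; last first.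
  by apply: IH => // i ki; have := leq_trans nk ki; rewrite leqNgt ltn_ord.
pose K := Ordinal kn.
have e0 i : (0 <= e i)%R.
  by rewrite -lee_fin -fe; apply: integral_ge0 => w _; rewrite lee_fin.
have mfX i : measurable_fun setT (fun w => f i (X i w)).
  exact: measurableT_comp.
pose Z w := (\prod_(i | i != K) f i (X i w))%R.
have mZ : measurable_fun setT Z.
  rewrite /Z; under eq_fun do rewrite big_mkcond/=.
  by apply: measurable_prod => i _; case: (i != K).
have Z0 w : (0 <= Z w)%R by apply: prodr_ge0.
pose C := (\prod_(i | i != K) e i)%R.
have C0 : (0 <= C)%R by apply: prodr_ge0.
pose D := density_measure P mZ Z0.
have lawXK A : measurable A ->
    pushforward D (X K) A = mscale (NngNum C0) (distribution P (X K)) A.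
  move=> mA; rewrite /pushforward /mscale/= /distribution /pushforward/=.
  pose f' i := if i == K then \1_A else f i.
  pose e' i := if i == K then fine (P (X K @^-1` A)) else e i.
  have mXA : measurable (X K @^-1` A).
    by rewrite -[_ @^-1` _]setTI; exact: measurable_funP.
  have e'C : (\prod_i e' i = C * fine (P (X K @^-1` A)))%R.
    rewrite (bigD1 K)//= mulrC /e' eqxx; congr (_ * _)%R.
    by apply: eq_bigr => i /negbTE ->.
  have := IH f' e'; rewrite e'C EFinM fineK ?fin_num_measure// => <-.
  - rewrite /D /density_measure integral_mkcond; apply: eq_integral => w _.
    rewrite patchE (bigD1 K)//= /f' eqxx indicE.
    have -> : (X K w \in A) = (w \in X K @^-1` A).
      by apply/idP/idP; rewrite !inE.
    case: ifPn => wA; rewrite ?mul1r ?mul0r//.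
    by rewrite /Z; congr EFin; apply: eq_bigr => i /negbTE ->.
  - by move=> i; rewrite /f'; case: ifP.
  - by move=> i x; rewrite /f'; case: ifP => // _; rewrite indicE.
  - move=> i ki; rewrite /f'; case: eqP => [_|iK]; first by exists A.
    apply: find; rewrite ltn_neqAle ki andbT; apply/eqP => kiE.
    by apply: iK; exact/val_inj.
  - move=> i; rewrite /f' /e'; case: eqP => [->|//].
    by rewrite fineK ?fin_num_measure// -integral_indicT.
have mEf : measurable_fun setT (EFin \o f K) by exact/measurable_EFinP.
transitivity (\int[D]_w (f K (X K w))%:E).
  rewrite ge0_integral_density//.
  - by apply: eq_integral => w _; rewrite (bigD1 K)//= EFinM.
  - exact/measurable_EFinP.
  - by move=> w; rewrite lee_fin.
have -> : \int[D]_w (f K (X K w))%:E = \int[pushforward D (X K)]_x (f K x)%:E.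
  by rewrite ge0_integral_pushforward// => x _; rewrite lee_fin.
rewrite (eq_measure_integral (mscale (NngNum C0) (distribution P (X K)))); last first.
  by move=> A mA _; exact: lawXK.
rewrite ge0_integral_mscale//=; last by move=> x _; rewrite lee_fin.
rewrite ge0_integral_distribution//; last by move=> x; rewrite lee_fin.
by rewrite fe (bigD1 K)//= EFinM muleC.
Qed.

Lemma expectation_prod (f : 'I_n -> R -> R) (e : 'I_n -> R) :
  (forall i, measurable_fun setT (f i)) ->
  (forall i x, (0 <= f i x)%R) ->
  (forall i, \int[P]_w (f i (X i w))%:E = (e i)%:E) ->
  \int[P]_w (\prod_i f i (X i w))%:E = (\prod_i e i)%:E.
Proof.
move=> mf f0 fe; apply: (@expectation_prod_prefix n) => // i.
by rewrite leqNgt ltn_ord.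
Qed.

End product_expectation.

(** * Finite measures on tuples are determined by boxes *)

Section tuple_measures.
Local Open Scope ereal_scope.
Context (R : realType) (n : nat) d (T : measurableType d).

Definition box (A : 'I_n -> set T) : set (n.-tuple T) :=
  [set x | forall i, A i (tnth x i)].

Lemma measurable_box (A : 'I_n -> set T) :
  (forall i, measurable (A i)) -> measurable (box A).
Proof.
move=> mA.
rewrite (_ : box A = \bigcap_(i in [set: 'I_n]) ((@tnth n T ^~ i) @^-1` A i)).
  apply: fin_bigcap_measurable => // i _.
  by rewrite -[_ @^-1` _]setTI; exact: measurable_tnth.
by apply/seteqP; split => x /= xA => [i _|i]; exact: xA.
Qed.

Lemma measure_tuple_unique (m1 m2 : {measure set (n.-tuple T) -> \bar R}) :
  m1 setT < +oo ->
  (forall A, (forall i, measurable (A i)) -> m1 (box A) = m2 (box A)) ->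
  forall E, measurable E -> m1 E = m2 E.
Proof.
move=> m1oo m12.
pose G := [set B | exists2 A, (forall i, measurable (A i)) & B = box A].
have boxT : setT = box (fun=> setT) by apply/seteqP.
have GT : G setT by exists (fun=> setT).
apply: (measure_unique G (fun=> setT)) => //.
- rewrite eqEsubset; split.
    apply: smallest_sub; first exact: smallest_sigma_algebra.
    rewrite -[X in X `<=` _](bigcup_seq _ _) => B [i _ [A mA <-]].
    (* a cylinder over the i-th coordinate is a box with all other sides full *)
    apply: sub_sigma_algebra; rewrite setTI.
    exists (fun j => if j == i then A else setT).
      by move=> j; case: ifP.
    apply/seteqP; split => x /=; first by move=> Ax j; case: eqP => // ->.
    by move=> /(_ i); rewrite eqxx.
  apply: smallest_sub; first exact: sigma_algebra_measurable.
  by move=> _ [A mA ->]; exact: measurable_box.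
- move=> _ _ [A mA ->] [B mB ->]; exists (fun i => A i `&` B i).
    by move=> i; exact: measurableI.
  apply/seteqP; split => x /=; first by move=> [xA xB] i.
  by move=> xAB; split => i; have [] := xAB i.
- by rewrite bigcup_const.
- by move=> _ [A mA ->]; exact: m12.
Qed.

End tuple_measures.

(** * Scaling of the Lebesgue, uniform and exponential laws *)

Section scaling.
Local Open Scope ereal_scope.
Context (R : realType).
Local Notation mu := (@lebesgue_measure R).

Lemma lebesgue_measure_scale (s : R) (A : set R) : (0 < s)%R -> measurable A ->
  mu A = s%:E * mu ( *%R s @^-1` A).
Proof.
move=> s0 mA.
have ms : measurable_fun setT ( *%R s : measurableTypeR R -> measurableTypeR R).
  exact: mulrl_measurable.
rewrite (@lebesgue_measure_unique _
  (mscale (NngNum (ltW s0)) (pushforward mu ( *%R s : _ -> measurableTypeR R))))//.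
move=> _ [[a b] _ <-].
transitivity (s%:E * mu `](a / s)%R, (b / s)%R]%classic).
  rewrite !lebesgue_measure_itv/= !lte_fin ltr_pM2r ?invr_gt0//.
  case: ifPn => _; last by rewrite mule0.
  by rewrite -!EFinB -EFinM -mulrBl mulrCA divff ?gt_eqF// mulr1.
congr (_ * mu _); apply/seteqP.
by split=> x /=; rewrite !in_itv/= ltr_pdivrMr// ler_pdivlMr// ![(x * _)%R]mulrC.
Qed.

Lemma ge0_integral_scale (s : R) (f : R -> \bar R) : (0 < s)%R ->
  measurable_fun setT f -> (forall x, 0 <= f x) ->
  \int[mu]_x f x = s%:E * \int[mu]_x f (s * x)%R.
Proof.
move=> s0 mf f0.
have ms : measurable_fun setT ( *%R s : measurableTypeR R -> measurableTypeR R).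
  exact: mulrl_measurable.
rewrite (eq_measure_integral
  (mscale (NngNum (ltW s0)) (pushforward mu ( *%R s : _ -> measurableTypeR R)))).
  rewrite ge0_integral_mscale//; congr (_ * _).
  by rewrite ge0_integral_pushforward.
by move=> A mA _; exact: lebesgue_measure_scale.
Qed.

End scaling.

Section scaled_uniform.
Local Open Scope ereal_scope.
Context (R : realType) (theta s : R) (theta0 : (0 < theta)%R) (s0 : (0 < s)%R).
Local Notation mu := (@lebesgue_measure R).

Lemma integral_uniform_scale (stheta0 : (0 < s * theta)%R) (f : R -> \bar R) :
  measurable_fun setT f -> (forall x, 0 <= f x) ->
  \int[uniform_prob theta0]_x f (s * x)%R = \int[uniform_prob stheta0]_x f x.
Proof.
move=> mf f0; rewrite !integral_uniform//; last first.
  by apply: measurableT_comp => //; exact: mulrl_measurable.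
rewrite !subr0 invfM mulrC EFinM -muleA; congr (_ * _).
rewrite [in RHS]integral_mkcond (ge0_integral_scale s0); last 2 first.
- by apply/(measurable_restrictT _ _).1 => //; exact: measurable_funTS.
- by move=> x; apply: erestrict_ge0.
rewrite muleA -EFinM mulVf ?gt_eqF// mul1e [LHS]integral_mkcond.
apply: eq_integral => x _; rewrite !patchE.
congr (if _ then _ else _); apply/idP/idP; rewrite !inE/= !in_itv/=.
  by move=> /andP[x0 xt]; rewrite mulr_ge0 ?(ltW s0)//= ler_pM2l.
by rewrite pmulr_rge0// ler_pM2l.
Qed.

Lemma uniform_prob_scale (stheta0 : (0 < s * theta)%R) (A : set R) :
  measurable A ->
  \int[uniform_prob theta0]_x (\1_A (s * x)%R)%:E = uniform_prob stheta0 A.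
Proof.
move=> mA; rewrite (@integral_uniform_scale _ (EFin \o \1_A))//.
- by rewrite integral_indic// setIT.
- exact/measurable_EFinP.
- by move=> x; rewrite lee_fin.
Qed.

(** The density of the exponential law of rate lambda divided by s, restricted
    to [0, theta], with respect to the uniform law on [0, theta]. *)
Definition exponential_uniform_ratio (lambda x : R) : R :=
  (s * theta * (lambda * expR (- lambda * (s * x))))%R.

Lemma exponential_prob_uniform (lambda : R) (A : set R) : (0 < lambda)%R ->
  measurable A ->
  \int[uniform_prob theta0]_x
    (\1_A (s * x)%R * exponential_uniform_ratio lambda x)%:E =
  exponential_prob lambda (A `&` `[0%R, (s * theta)%R]).
Proof.
move=> l0 mA; have st0 : (0 < s * theta)%R by exact: mulr_gt0.
pose f x := (\1_A x * (s * theta * (lambda * expR (- lambda * x))))%R.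
have mexp : measurable_fun setT (fun x : R => expR (- lambda * x)).
  by apply: measurableT_comp => //; exact: mulrl_measurable.
rewrite (@integral_uniform_scale st0 (EFin \o f)); last 2 first.
- apply/measurable_EFinP; apply: measurable_funM => //.
  by apply: measurable_funM => //; exact: measurable_funM.
- by move=> x; rewrite lee_fin !mulr_ge0 ?expR_ge0// ltW.
rewrite integral_uniform//; last 2 first.
- apply/measurable_EFinP; apply: measurable_funM => //.
  by apply: measurable_funM => //; exact: measurable_funM.
- by move=> x; rewrite lee_fin !mulr_ge0 ?expR_ge0// ltW.
rewrite subr0 -ge0_integralZl//; last 3 first.
- apply/measurable_EFinP; apply: measurable_funTS; apply: measurable_funM => //.
  by apply: measurable_funM => //; exact: measurable_funM.
- by move=> x _; rewrite lee_fin !mulr_ge0 ?expR_ge0// ltW.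
- by rewrite lee_fin invr_ge0 ltW.
rewrite /exponential_prob integral_mkcondl; apply: eq_integral => x.
rewrite inE/= in_itv/= => /andP[x0 _].
rewrite patchE /f indicE -EFinM; case: ifPn => _; last by rewrite mul0r mulr0.
by rewrite mul1r mulKf ?gt_eqF// exponential_pdfE.
Qed.

End scaled_uniform.

(** * Change of variables between iid samples *)

Section weighted_sample.
Local Open Scope ereal_scope.
Context (R : realType) (n : nat) d (T : measurableType d).
Variables (X : 'I_n -> {mfun T >-> R}).

Lemma measurable_tuple_comp (phi : R -> R) : measurable_fun setT phi ->
  measurable_fun setT (fun w => [tuple phi (X i w) | i < n]).
Proof.
move=> mphi; apply/measurable_fun_tnthP => i.
rewrite (_ : _ \o _ = phi \o X i); last by apply/funext => w /=; rewrite tnth_mktuple.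
exact: measurableT_comp.
Qed.

Lemma measurable_sample : measurable_fun setT (sample X).
Proof. exact: (measurable_tuple_comp (@measurable_id _ _ setT)). Qed.

Lemma measurable_prod_sample (g : R -> R) : measurable_fun setT g ->
  measurable_fun setT (fun w => \prod_i g (X i w))%R.
Proof. by move=> mg; apply: measurable_prod => i _; exact: measurableT_comp. Qed.

Lemma prod_sample_ge0 (g : R -> R) : (forall x, (0 <= g x)%R) ->
  forall w, (0 <= \prod_i g (X i w))%R.
Proof. by move=> g0 w; exact: prodr_ge0. Qed.

(** The image by phi, coordinate by coordinate, of the law of the sample, with
    each coordinate weighted by g. *)
Definition weighted_sample_law (P : probability T R) (phi g : R -> R)
    (mg : measurable_fun setT g) (g0 : forall x, (0 <= g x)%R) :=
  pushforward (density_measure P (measurable_prod_sample mg) (prod_sample_ge0 g0))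
    (fun w => [tuple phi (X i w) | i < n]).

Lemma weighted_sample_law_box (P : probability T R) (U : {measure set R -> \bar R})
    (phi g : R -> R) (mphi : measurable_fun setT phi)
    (mg : measurable_fun setT g) (g0 : forall x, (0 <= g x)%R)
    (A : 'I_n -> set R) :
  iid X P U -> \int[U]_x (g x)%:E < +oo -> (forall i, measurable (A i)) ->
  weighted_sample_law P phi mg g0 (box A) =
  (\prod_i fine (\int[U]_x (\1_(A i) (phi x) * g x)%:E))%:E.
Proof.
move=> [indX lawX] goo mA.
have mf i : measurable_fun setT (fun x => \1_(A i) (phi x) * g x)%R.
  apply: measurable_funM => //.
  exact: (measurableT_comp (measurable_indic (mA i)) mphi).
have f0 i x : (0 <= \1_(A i) (phi x) * g x)%R by rewrite mulr_ge0// indicE.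
rewrite -(expectation_prod indX mf f0); last first.
  move=> i; rewrite fineK; last first.
    rewrite ge0_fin_numE; last by apply: integral_ge0 => x _; rewrite lee_fin.
    apply: le_lt_trans goo; apply: ge0_le_integral => //.
    - by move=> x _; rewrite lee_fin.
    - exact/measurable_EFinP.
    - exact/measurable_EFinP.
    - by move=> x _; rewrite lee_fin ler_piMl// indicE; case: (_ \in _).
  rewrite -(@ge0_integral_distribution _ _ _ _ _ P (X i)
    (EFin \o (fun x => \1_(A i) (phi x) * g x)%R)).
  - by apply: eq_measure_integral => B mB _; exact: lawX.
  - exact/measurable_EFinP.
  - by move=> x; rewrite lee_fin.
rewrite /weighted_sample_law /pushforward /density_measure integral_mkcond.
apply: eq_integral => w _; rewrite patchE big_split/=.
set b := (\prod_i \1_(A i) _)%R.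
set S := (X in w \in X).
suff -> : b = (w \in S)%:R.
  by case: (w \in S); rewrite ?mul1r ?mul0r.
rewrite /b; case: (boolP (w \in _)) => [|wA].
  rewrite inE => wA; rewrite big1// => i _; rewrite indicE mem_set//.
  by have := wA i; rewrite tnth_mktuple.
have [i wAi] : exists i, ~ A i (phi (X i w)).
  apply: contrapT => /forallNP h; move/negP: wA; apply.
  by rewrite inE => i; rewrite tnth_mktuple; apply: contrapT; exact: h.
by rewrite (bigD1 i)//= indicE memNset// mul0r.
Qed.

(** If the weighted images of the two marginal laws agree as measures on the
    line, then so do those of the samples, as measures on tuples: on a box both
    are the same product of one-dimensional integrals. *)
Lemma ge0_integral_iid_change (P Q : probability T R) (U V : {measure set R -> \bar R})
    (phi psi g k : R -> R) (h : n.-tuple R -> \bar R) :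
  iid X P U -> iid X Q V ->
  measurable_fun setT phi -> measurable_fun setT psi ->
  measurable_fun setT g -> (forall x, (0 <= g x)%R) ->
  measurable_fun setT k -> (forall x, (0 <= k x)%R) ->
  \int[U]_x (g x)%:E < +oo ->
  (forall A, measurable A -> \int[U]_x (\1_A (phi x) * g x)%:E =
                             \int[V]_x (\1_A (psi x) * k x)%:E) ->
  measurable_fun setT h -> (forall x, 0 <= h x) ->
  \int[P]_w (h [tuple phi (X i w) | i < n] * (\prod_i g (X i w))%:E) =
  \int[Q]_w (h [tuple psi (X i w) | i < n] * (\prod_i k (X i w))%:E).
Proof.
move=> iidP iidQ mphi mpsi mg g0 mk k0 goo gk mh h0.
have koo : \int[V]_x (k x)%:E < +oo.
  have := gk setT measurableT.
  under eq_integral do rewrite indicE in_setT mul1r.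
  by under [in RHS]eq_integral do rewrite indicE in_setT mul1r; move=> <-.
have mphiX := measurable_tuple_comp mphi.
have mpsiX := measurable_tuple_comp mpsi.
pose DP := density_measure P (measurable_prod_sample mg) (prod_sample_ge0 g0).
pose DQ := density_measure Q (measurable_prod_sample mk) (prod_sample_ge0 k0).
transitivity (\int[DP]_w h [tuple phi (X i w) | i < n]).
  rewrite ge0_integral_density//.
  exact: (measurableT_comp mh mphiX).
transitivity (\int[DQ]_w h [tuple psi (X i w) | i < n]); last first.
  rewrite ge0_integral_density//.
  exact: (measurableT_comp mh mpsiX).
transitivity (\int[pushforward DP (fun w => [tuple phi (X i w) | i < n])]_x h x).
  by rewrite ge0_integral_pushforward.
transitivity (\int[pushforward DQ (fun w => [tuple psi (X i w) | i < n])]_x h x); last first.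
  by rewrite ge0_integral_pushforward.
apply: eq_measure_integral => E mE _.
apply: measure_tuple_unique => //=.
  rewrite (_ : setT = box (fun=> setT)); last by apply/seteqP.
  rewrite -/(weighted_sample_law P phi mg g0 (box (fun=> setT))).
  by rewrite (weighted_sample_law_box _ _ _ iidP)// ltry.
move=> A mA.
rewrite -/(weighted_sample_law P phi mg g0 (box A)).
rewrite -/(weighted_sample_law Q psi mk k0 (box A)).
rewrite (weighted_sample_law_box _ _ _ iidP)//.
rewrite (weighted_sample_law_box _ _ _ iidQ)//.
by congr EFin; apply: eq_bigr => i _; rewrite gk.
Qed.

End weighted_sample.

(** * The mean/max statistic *)

(** Inversion is continuous away from 0, and 0^-1 = 0. *)
Lemma measurable_funV d (T : measurableType d) (R : realType) (f : T -> R) :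
  measurable_fun setT f -> measurable_fun setT (fun x => (f x)^-1).
Proof.
move=> mf.
suff minv : measurable_fun setT (fun x : R => x^-1) by exact: measurableT_comp mf.
have openD : open [set x : R | x != 0] by exact: open_neq.
rewrite (_ : (fun x : R => x^-1) = GRing.inv \_ [set x : R | x != 0]).
  apply/(measurable_restrictT _ _).1; first exact: open_measurable.
  apply: open_continuous_measurable_fun => //= x.
  by rewrite inE/= => x0; exact: inv_continuous.
apply/funext => x; rewrite patchE.
by case: ifPn => //; rewrite notin_setE/= => /negP; rewrite negbK => /eqP ->; rewrite invr0.
Qed.

Section sample_statistics.
Context (R : realType) (n : nat).
Implicit Types x : n.-tuple R.

Lemma measurable_sample_max : measurable_fun setT (@sample_max R n).
Proof.
rewrite /sample_max; elim: (index_enum _) => [|i s IH].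
  by under eq_fun do rewrite big_nil; exact: measurable_cst.
under eq_fun do rewrite big_cons.
by apply: measurable_maxr => //; exact: measurable_tnth.
Qed.

Lemma measurable_mean_max : measurable_fun setT (@mean_max R n).
Proof.
apply: measurable_funM; last exact: measurable_funV measurable_sample_max.
apply: measurable_funM => //; apply: measurable_sum => i.
exact: measurable_tnth.
Qed.

Lemma measurable_nonneg_samples : measurable (@nonneg_samples R n).
Proof.
rewrite (_ : nonneg_samples = box (fun _ : 'I_n => (`[0%R, +oo[%classic : set R))).
  by apply: measurable_box => i; exact: measurable_itv.
apply/seteqP; split => x xA i; have := xA i; first by rewrite /= in_itv/= andbT.
by rewrite /= in_itv/= andbT.
Qed.

Lemma sample_max_ge0 x : 0 <= sample_max x.
Proof. by rewrite /sample_max; exact: bigmax_ge_id. Qed.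

Lemma sample_max_le x a : 0 <= a ->
  (sample_max x <= a) <-> (forall i, tnth x i <= a).
Proof.
move=> a0; split=> [/bigmax_leP[_ h] i|h]; first exact: h.
by apply/bigmax_leP.
Qed.

Lemma sample_max_scale t x : 0 < t ->
  sample_max (scale_sample t x) = t * sample_max x.
Proof.
move=> t0; apply/eqP; rewrite eq_le; apply/andP; split.
  apply/sample_max_le; first by rewrite mulr_ge0 ?sample_max_ge0// ltW.
  move=> i; rewrite tnth_mktuple ler_pM2l//.
  exact: (sample_max_le x (sample_max_ge0 x)).1.
rewrite mulrC -ler_pdivlMr//; apply/sample_max_le.
  by rewrite divr_ge0 ?sample_max_ge0// ltW.
move=> i; rewrite ler_pdivlMr// mulrC.
have := (sample_max_le (scale_sample t x) (sample_max_ge0 _)).1 (lexx _) i.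
by rewrite tnth_mktuple.
Qed.

Lemma mean_max_scale t x : 0 < t -> mean_max (scale_sample t x) = mean_max x.
Proof.
move=> t0; rewrite /mean_max sample_max_scale// /sample_mean.
under eq_bigr do rewrite tnth_mktuple.
by rewrite -mulr_sumr -(mulrA t) invfM mulrACA divff ?gt_eqF// mul1r.
Qed.

Lemma scale_free_mean_max_test c : scale_free_test (@mean_max_test R n c).
Proof.
split; last by move=> t x t0 _; rewrite /mean_max_test mean_max_scale.
apply: measurable_funTS; apply: measurable_fun_ler => //.
exact: measurable_mean_max.
Qed.

Lemma nonneg_samples_scale t x : 0 < t ->
  nonneg_samples x -> nonneg_samples (scale_sample t x).
Proof.
by move=> t0 x0 i; rewrite tnth_mktuple mulr_ge0// ltW.
Qed.

End sample_statistics.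

(** * Likelihood ratio of scale-free events *)

Section power_integral.
Local Open Scope ereal_scope.
Context (R : realType).
Local Notation mu := (@lebesgue_measure R).

Lemma integral_power n (a : R) : (0 < n)%N -> (0 < a)%R ->
  \int[mu]_(r in `]0%R, a]) (n%:R * r ^+ n.-1)%:E = (a ^+ n)%:E.
Proof.
move=> n0 a0; rewrite integral_itv_obnd_cbnd; last first.
  by apply/measurable_EFinP; apply: measurable_funM => //; exact: measurable_funX.
rewrite (@continuous_FTC2 _ _ (fun r => r ^+ n)%R)//.
- by rewrite expr0n -(prednK n0)/= sube0.
- apply: continuous_subspaceT => x.
  apply: (@continuousM _ R^o (fun=> n%:R) (fun r => r ^+ n.-1)%R).
    exact: cst_continuous.
  exact: exprn_continuous.
- split.
  + by move=> x _; exact: exprn_derivable.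
  + by apply/cvg_at_right_filter; exact: exprn_continuous.
  + by apply/cvg_at_left_filter; exact: exprn_continuous.
- by move=> x _; rewrite exp_derive1.
Qed.

End power_integral.

Section likelihood_ratio.
Local Open Scope ereal_scope.
Context (R : realType).
Local Notation mu := (@lebesgue_measure R).

(** For positive lambda and t, with v = 1 / u, this is the Gamma integral of
    n lambda^n v^(n-1) exp(- lambda n t v), that is n! / (n t)^n. *)
Definition likelihood_ratio (n : nat) (lambda t : R) : \bar R :=
  \int[mu]_(u in `]0%R, +oo[)
    (n%:R * u ^+ n.-1 * (lambda / u ^+ 2) ^+ n *
     expR (- (lambda * (n%:R * t) / u)))%:E.

(** The density of r ^ n; it is extended by 0 so that integrals over the whole
    line can be exchanged and rescaled. *)
Definition power_weight (n : nat) (r : R) : R :=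
  if (0 < r)%R then (n%:R * r ^+ n.-1)%R else 0%R.

Lemma power_weight_ge0 n r : (0 <= power_weight n r)%R.
Proof.
by rewrite /power_weight; case: ifPn => // r0; rewrite mulr_ge0// exprn_ge0// ltW.
Qed.

Lemma measurable_power_weight n : measurable_fun setT (power_weight n).
Proof.
apply: measurable_fun_ifT => //; first exact: measurable_fun_ltr.
by apply: measurable_funM => //; exact: measurable_funX.
Qed.

(** The indicator of [0, a] at x, as a function of both arguments: a varies with
    the scale, and joint measurability is needed. *)
Definition within (a x : R) : R := if (0 <= x <= a)%R then 1%R else 0%R.

Lemma within_ge0 a x : (0 <= within a x)%R.
Proof. by rewrite /within; case: ifP. Qed.

Lemma measurable_within d (T : measurableType d) (f g : T -> R) :
  measurable_fun setT f -> measurable_fun setT g ->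
  measurable_fun setT (fun z => within (f z) (g z)).
Proof.
move=> mf mg; apply: measurable_fun_ifT => //.
by apply: measurable_and; exact: measurable_fun_ler.
Qed.

Lemma prod_within n (x : n.-tuple R) a : nonneg_samples x -> (0 <= a)%R ->
  (\prod_i within a (tnth x i) = (sample_max x <= a)%R%:R)%R.
Proof.
move=> x0 a0; case: (boolP (sample_max x <= a)%R) => [|xa].
  by move=> /sample_max_le - /(_ a0) xa; rewrite big1// => i _; rewrite /within x0 xa.
have [i xi] : exists i, ~ (tnth x i <= a)%R.
  apply: contrapT => /forallNP h; move/negP: xa; apply.
  by apply/sample_max_le => // i; apply: contrapT; exact: h.
by rewrite (bigD1 i)//= /within; move/negP/negbTE: xi => ->; rewrite andbF mul0r.
Qed.

Lemma integral_power_weight_within (n : nat) (theta M : R) : (0 < n)%N ->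
  (0 < theta)%R -> (0 < M)%R ->
  \int[mu]_r (power_weight n r * (M <= r^-1 * theta)%R%:R)%:E =
  ((theta / M) ^+ n)%:E.
Proof.
move=> n0 t0 M0; rewrite -integral_power ?divr_gt0// [RHS]integral_mkcond.
apply: eq_integral => r _; rewrite patchE /power_weight.
case: ifPn => [|]; first last.
  rewrite mul0r; case: ifPn => //; rewrite inE/= in_itv/= => /andP[r0 _].
  by rewrite r0.
move=> r0; have -> : (r \in `]0%R, (theta / M)%R]%classic) = (M <= r^-1 * theta)%R.
  apply/idP/idP; rewrite inE/= in_itv/= r0/= => h.
    by rewrite mulrC ler_pdivlMr// mulrC -ler_pdivlMr.
  by rewrite ler_pdivlMr// mulrC -ler_pdivlMr// mulrC.
by case: ifP; rewrite ?mulr1 ?mulr0.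
Qed.

End likelihood_ratio.

(** Lebesgue measure, hence also the uniform and the exponential laws, is a
    measure on a copy of the real line with the same measurable sets but another
    display than the line in which random variables take their values.  Pushing
    forward by the identity changes the display and nothing else. *)
Section standard_display.
Local Open Scope ereal_scope.
Context (R : realType).

Lemma measurable_idR : measurable_fun setT (idfun : measurableTypeR R -> R).
Proof. by move=> _ A mA; rewrite setTI. Qed.

Definition default_measure (m : {measure set (measurableTypeR R) -> \bar R}) :
  {measure set R -> \bar R}.
Proof.
refine (pushforward m (idfun : measurableTypeR R -> R)).
exact: measurable_idR.
Defined.

Lemma integral_default_measure (m : {measure set (measurableTypeR R) -> \bar R})
    (f : R -> \bar R) : measurable_fun setT f -> (forall x, 0 <= f x) ->
  \int[default_measure m]_x f x = \int[m]_x f x.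
Proof. by move=> mf f0; rewrite (ge0_integral_pushforward measurable_idR). Qed.

Definition exponential_law (lambda : R) (lambda0 : (0 < lambda)%R) :
  probability (measurableTypeR R) R.
Proof.
refine (exponential_prob lambda : probability (measurableTypeR R) R).
exact: lambda0.
Defined.

End standard_display.

Section change_of_hypothesis.
Local Open Scope ereal_scope.
Context (R : realType) (n : nat) d (T : measurableType d).
Variables (X : 'I_n -> {mfun T >-> R}).
Hypotheses (n_gt0 : (0 < n)%N) (X_ge0 : forall i w, (0 <= X i w)%R).
Variables (theta lambda : R) (theta0 : (0 < theta)%R) (lambda0 : (0 < lambda)%R).
Variables (P0 P1 : probability T R).
Hypotheses (iid0 : iid X P0 (uniform_prob theta0))
  (iid1 : iid X P1 (exponential_prob lambda)).
Variable E : set (n.-tuple R).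
Hypotheses (mE : measurable E)
  (E_pos : forall x, E x -> (0 < sample_max x)%R)
  (E_cone : forall t x, (0 < t)%R -> nonneg_samples x -> E (scale_sample t x) <-> E x).
Local Notation mu := (@lebesgue_measure R).
Local Notation S := (sample X).

Let S_ge0 w : nonneg_samples (S w).
Proof. by move=> i; rewrite tnth_mktuple. Qed.

Let tnthS w i : tnth (S w) i = X i w.
Proof. by rewrite tnth_mktuple. Qed.

(** For each w, f1 integrates over r to the indicator of E; for each r, f1
    integrates under P1 to the integral of f2 under P0; and for each w, f2
    integrates over r to the likelihood ratio on E. *)
Let f1 (z : T * R) : R :=
  (\1_E (S z.1) * (sample_max (S z.1) / theta) ^+ n * power_weight n z.2 *
   \prod_i within (z.2^-1 * theta) (X i z.1))%R.

Let f2 (z : T * R) : R :=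
  (\1_E (S z.1) * (z.2^-1 * sample_max (S z.1) / theta) ^+ n *
   power_weight n z.2 *
   \prod_i exponential_uniform_ratio theta z.2^-1 lambda (X i z.1))%R.

Let mS1 : measurable_fun setT (fun z : T * R => S z.1).
Proof. exact: (measurableT_comp (measurable_sample X) measurable_fst). Qed.

Let mX1 i : measurable_fun setT (fun z : T * R => X i z.1).
Proof. exact: (measurableT_comp (measurable_funPT (X i)) measurable_fst). Qed.

Let mE1 : measurable_fun setT (fun z : T * R => \1_E (S z.1) : R).
Proof. exact: (measurableT_comp (measurable_indic mE) mS1). Qed.

Let mM1 : measurable_fun setT (fun z : T * R => sample_max (S z.1)).
Proof. exact: (measurableT_comp (@measurable_sample_max R n) mS1). Qed.

Let mW2 : measurable_fun setT (fun z : T * R => power_weight n z.2).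
Proof. exact: (measurableT_comp (@measurable_power_weight R n) measurable_snd). Qed.

Let mV2 : measurable_fun setT (fun z : T * R => (z.2^-1)%R).
Proof. exact: (measurable_funV measurable_snd). Qed.

Let mf1 : measurable_fun setT f1.
Proof.
apply: measurable_funM.
  apply: measurable_funM => //; apply: measurable_funM => //.
  by apply: measurable_funX; exact: measurable_funM.
apply: measurable_prod => i _; apply: measurable_within => //.
exact: measurable_funM.
Qed.

Let mf2 : measurable_fun setT f2.
Proof.
apply: measurable_funM.
  apply: measurable_funM => //; apply: measurable_funM => //.
  apply: measurable_funX; apply: measurable_funM => //.
  exact: measurable_funM.
apply: measurable_prod => i _; rewrite /exponential_uniform_ratio.
apply: measurable_funM; first exact: measurable_funM.
apply: measurable_funM => //; apply: measurableT_comp => //.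
by apply: measurable_funM => //; exact: measurable_funM.
Qed.

Let indE_ge0 x : (0 <= \1_E x :> R)%R.
Proof. by rewrite indicE. Qed.

Let f1_ge0 z : (0 <= f1 z)%R.
Proof.
rewrite /f1 !mulr_ge0// ?power_weight_ge0//.
  by rewrite exprn_ge0// divr_ge0 ?sample_max_ge0// ltW.
by apply: prodr_ge0 => i _; exact: within_ge0.
Qed.

Let f2_ge0 z : (0 <= f2 z)%R.
Proof.
rewrite /f2; have [z0|z0] := leP z.2 0%R.
  by rewrite /power_weight ltNge z0 mulr0 mul0r.
rewrite !mulr_ge0// ?power_weight_ge0//.
  by rewrite exprn_ge0// divr_ge0 ?mulr_ge0 ?sample_max_ge0// ?invr_ge0 ltW.
apply: prodr_ge0 => i _; rewrite /exponential_uniform_ratio.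
by rewrite !mulr_ge0 ?expR_ge0// ?invr_ge0 ltW.
Qed.

Let integral_f1 w : \int[mu]_r (f1 (w, r))%:E = (\1_E (S w))%:E.
Proof.
rewrite indicE; case: (boolP (S w \in E)) => [Ew|Ew]; last first.
  rewrite integral0_eq// => r _.
  by rewrite /f1/= indicE (negbTE Ew) !mul0r.
have M0 : (0 < sample_max (S w))%R by apply: E_pos; rewrite -in_setE.
transitivity (\int[mu]_r (((sample_max (S w) / theta) ^+ n)%:E *
    (power_weight n r * (sample_max (S w) <= r^-1 * theta)%R%:R)%:E)).
  apply: eq_integral => r _; rewrite /f1/= indicE Ew mul1r -mulrA EFinM.
  congr (_ * _%:E); rewrite /power_weight; case: ifPn => [r0|_]; last by rewrite !mul0r.
  rewrite -prod_within//; last by rewrite mulr_ge0 ?invr_ge0 ?ltW.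
  by congr (_ * _)%R; apply: eq_bigr => i _; rewrite tnthS.
rewrite ge0_integralZl//.
- rewrite integral_power_weight_within// -EFinM -exprMn mulf_div.
  by rewrite [(theta * _)%R]mulrC divff ?expr1n// mulf_neq0// gt_eqF.
- apply/measurable_EFinP; apply: measurable_funM.
    exact: measurable_power_weight.
  apply: (@measurableT_comp _ _ _ _ _ _ (fun b : bool => (b%:R : R))) => //.
  apply: measurable_fun_ler => //; apply: measurable_funM => //.
  exact: measurable_funV.
- by move=> r _; rewrite lee_fin mulr_ge0 ?power_weight_ge0.
- by rewrite lee_fin exprn_ge0// divr_ge0 ?sample_max_ge0// ltW.
Qed.

(** At scale s = 1 / r, the exponential sample within the cube of side theta / r
    is s times a uniform sample, with density the product of the ratios; E is
    unchanged by s. *)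
Let integral_f1_f2 r :
  \int[P1]_w (f1 (w, r))%:E = \int[P0]_w (f2 (w, r))%:E.
Proof.
have [r0|r0] := leP r 0%R.
  rewrite !integral0_eq// => w _.
    by rewrite /f2/= /power_weight ltNge r0 mulr0 mul0r.
  by rewrite /f1/= /power_weight ltNge r0 mulr0 mul0r.
have s0 : (0 < r^-1)%R by rewrite invr_gt0.
pose h (x : n.-tuple R) : R :=
  (\1_E x * (sample_max x / theta) ^+ n * power_weight n r)%R.
have mh : measurable_fun setT h.
  apply: measurable_funM => //; apply: measurable_funM.
    exact: measurable_indic.
  apply: measurable_funX; apply: measurable_funM => //.
  exact: measurable_sample_max.
have h0 x : (0 <= h x)%R.
  rewrite /h !mulr_ge0 ?power_weight_ge0//.
  by rewrite exprn_ge0// divr_ge0 ?sample_max_ge0// ltW.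
have mratio : measurable_fun setT (exponential_uniform_ratio theta r^-1 lambda).
  apply: measurable_funM => //; apply: measurable_funM => //.
  by apply: measurableT_comp => //; do 2 apply: measurable_funM => //.
have ratio0 x : (0 <= exponential_uniform_ratio theta r^-1 lambda x)%R.
  by rewrite /exponential_uniform_ratio !mulr_ge0 ?expR_ge0// ltW.
have mwithin : measurable_fun setT (within (r^-1 * theta)).
  exact: (measurable_within (measurable_cst _) (@measurable_id _ _ setT)).
pose U := default_measure (uniform_prob theta0).
pose V := default_measure (exponential_law lambda0).
have ratioP A : measurable A ->
    \int[U]_x (\1_A (r^-1 * x) * exponential_uniform_ratio theta r^-1 lambda x)%:E =
    V (A `&` `[0%R, (r^-1 * theta)%R]).
  move=> mA; rewrite integral_default_measure.
  - exact: exponential_prob_uniform.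
  - apply/measurable_EFinP; apply: measurable_funM => //.
    exact: (measurableT_comp (measurable_indic mA) (mulrl_measurable _)).
  - by move=> x; rewrite lee_fin mulr_ge0// indicE.
have withinP A : measurable A ->
    \int[V]_x (\1_A x * within (r^-1 * theta) x)%:E =
    V (A `&` `[0%R, (r^-1 * theta)%R]).
  move=> mA; transitivity (\int[V]_x (\1_(A `&` `[0%R, (r^-1 * theta)%R]) x)%:E);
    last by rewrite integral_indic ?setIT//; exact: measurableI.
  apply: eq_integral => x _; rewrite indicI/= /within; congr ((_ * _)%:E)%R.
  by rewrite [RHS]indicE mem_setE/= in_itv/=; case: ifP.
have H := ge0_integral_iid_change (U := U) (V := V) (h := EFin \o h) iid0 iid1
  (mulrl_measurable r^-1) (@measurable_id _ _ setT)
  mratio ratio0 mwithin (within_ge0 _).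
transitivity (\int[P1]_w ((EFin \o h) [tuple X i w | i < n] *
    (\prod_i within (r^-1 * theta) (X i w))%:E)).
  by apply: eq_integral => w _; rewrite /f1 /h/= -EFinM.
rewrite -H//.
- apply: eq_integral => w _; rewrite /f2/= -EFinM; congr (_ * _)%:E.
  rewrite (_ : [tuple _ | _ < _] = scale_sample r^-1 (S w)); last first.
    by apply: eq_from_tnth => i; rewrite !tnth_mktuple.
  rewrite /h sample_max_scale//; congr (_ * _ * _)%R.
  rewrite !indicE; congr (nat_of_bool _)%:R.
  by apply/idP/idP; rewrite !in_setE => /E_cone; apply.
- have := ratioP _ measurableT.
  under eq_integral do rewrite indicE in_setT mul1r.
  move=> ->; apply: (@le_lt_trans _ _ 1); last exact: ltry.
  rewrite setTI; apply: (@probability_le1 _ _ _ (exponential_law lambda0)).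
  exact: measurable_itv.
- by move=> A mA; rewrite ratioP// withinP.
- exact/measurable_EFinP.
Qed.

(** All powers of M cancel. *)
Let ratio_homogeneity (M u e : R) : (0 < M)%R -> (0 < u)%R ->
  (M * (((M * u)^-1 * M / theta) ^+ n * (n%:R * (M * u) ^+ n.-1) *
        (((M * u)^-1 * theta * lambda) ^+ n * e)) =
   n%:R * u ^+ n.-1 * (lambda / u ^+ 2) ^+ n * e)%R.
Proof.
move=> M0 u0; set a := ((M * u)^-1 * M / theta)%R.
set b := ((M * u)^-1 * theta * lambda)%R.
have -> : (lambda / u ^+ 2 = a * b * M)%R.
  by rewrite /a /b; field; rewrite !gt_eqF.
have -> : ((a * b * M) ^+ n = a ^+ n * b ^+ n * (M * M ^+ n.-1))%R.
  by rewrite -exprS prednK// !exprMn.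
have -> : ((M * u) ^+ n.-1 = M ^+ n.-1 * u ^+ n.-1)%R by rewrite exprMn.
move: (a ^+ n)%R (b ^+ n)%R (M ^+ n.-1)%R (u ^+ n.-1)%R (n%:R : R) => A B Mn un N.
by ring.
Qed.

(** The substitution r = M u, M being the maximum of the sample. *)
Let integral_f2 w :
  \int[mu]_r (f2 (w, r))%:E =
  (\1_E (S w))%:E * likelihood_ratio n lambda (mean_max (S w)).
Proof.
rewrite indicE; case: (boolP (S w \in E)) => [Ew|Ew]; last first.
  rewrite mul0e integral0_eq// => r _.
  by rewrite /f2/= indicE (negbTE Ew) !mul0r.
rewrite mul1e.
have M0 : (0 < sample_max (S w))%R by apply: E_pos; rewrite -in_setE.
rewrite (ge0_integral_scale M0); last 2 first.
- apply/measurable_EFinP; apply: (measurableT_comp mf2).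
  exact: measurable_pair1.
- by move=> r; rewrite lee_fin.
rewrite -ge0_integralZl//; last 3 first.
- apply/measurable_EFinP; apply: (measurableT_comp mf2).
  by apply: measurable_fun_pair => //; exact: mulrl_measurable.
- by move=> r _; rewrite lee_fin.
- by rewrite lee_fin ltW.
rewrite /likelihood_ratio [RHS]integral_mkcond; apply: eq_integral => u _.
rewrite patchE -EFinM /f2/= indicE Ew mul1r /power_weight pmulr_rgt0//.
have -> : (u \in `]0%R, +oo[%classic) = (0 < u)%R.
  by rewrite mem_setE/= in_itv/= andbT.
case: ifPn => u0; last by rewrite mulr0 mul0r mulr0.
congr EFin.
set M := sample_max (S w) in M0 *.
have -> : (\prod_(i < n) exponential_uniform_ratio theta (M * u)^-1 lambda (X i w) =
  ((M * u)^-1 * theta * lambda) ^+ n *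
  expR (- (lambda * (n%:R * mean_max (S w)) / u)))%R.
  under eq_bigr do rewrite /exponential_uniform_ratio mulrA.
  rewrite big_split/= prodr_const card_ord; congr (_ * _)%R.
  rewrite -expR_sum -mulr_sumr -mulr_sumr mulNr; congr (expR (- _))%R.
  rewrite /mean_max /sample_mean -/M.
  under [in RHS]eq_bigr do rewrite tnthS.
  by field; rewrite !gt_eqF// ltr0n.
exact: ratio_homogeneity.
Qed.

Lemma exponential_probability_cone :
  P1 [set w | E (S w)] =
  \int[P0]_(w in [set w | E (S w)]) likelihood_ratio n lambda (mean_max (S w)).
Proof.
have mSE : measurable [set w | E (S w)].
  by rewrite -[X in measurable X]setTI; exact: measurable_sample.
have mstd : measurable_fun setT (fun z : T * measurableTypeR R => (z.1, z.2) : T * R).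
  apply: measurable_fun_pair; first exact: measurable_fst.
  exact: (measurableT_comp (@measurable_idR R) measurable_snd).
transitivity (\int[P1]_w \int[mu]_r (f1 (w, r))%:E).
  under eq_integral do rewrite integral_f1.
  rewrite (_ : (fun w => (\1_E (S w))%:E) = EFin \o \1_[set w | E (S w)]).
    by rewrite integral_indic// setIT.
  by apply/funext => w /=; rewrite !indicE; congr (nat_of_bool _)%:R%:E; apply/idP/idP; rewrite !in_setE.
rewrite (fubini_tonelli (fun z : T * measurableTypeR R => (f1 (z.1, z.2))%:E)) => [||z]; last 2 first.
- by apply/measurable_EFinP; exact: (measurableT_comp mf1 mstd).
- by rewrite lee_fin.
under eq_integral do rewrite /= integral_f1_f2.
rewrite -(fubini_tonelli (fun z : T * measurableTypeR R => (f2 (z.1, z.2))%:E)) => [||z]; last 2 first.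
- by apply/measurable_EFinP; exact: (measurableT_comp mf2 mstd).
- by rewrite lee_fin.
rewrite [RHS]integral_mkcond; apply: eq_integral => w _.
rewrite /= integral_f2 patchE indicE.
have -> : (S w \in E) = (w \in [set w | E (S w)]).
  by apply/idP/idP; rewrite !in_setE.
by case: ifP; rewrite ?mul1e ?mul0e.
Qed.

End change_of_hypothesis.

Section likelihood_ratio_theory.
Local Open Scope ereal_scope.
Context (R : realType) (n : nat) (lambda : R) (lambda0 : (0 < lambda)%R).
Local Notation mu := (@lebesgue_measure R).

Let integrand (z : R * R) : R :=
  (power_weight n z.2 * (lambda / z.2 ^+ 2) ^+ n *
   expR (- (lambda * (n%:R * z.1) / z.2)))%R.

Let integrand_ge0 z : (0 <= integrand z)%R.
Proof.
rewrite /integrand !mulr_ge0 ?expR_ge0 ?power_weight_ge0// exprn_ge0//.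
by rewrite divr_ge0 ?sqr_ge0// ltW.
Qed.

Let measurable_integrand : measurable_fun setT integrand.
Proof.
have mV := measurable_funV (@measurable_snd _ _ R R).
apply: measurable_funM; first apply: measurable_funM.
- exact: (measurableT_comp (@measurable_power_weight R n) measurable_snd).
- apply: measurable_funX; apply: measurable_funM => //.
  by apply: measurable_funV; exact: measurable_funX.
- apply: measurableT_comp => //; apply: measurableT_comp => //.
  by apply: measurable_funM => //; do 2 apply: measurable_funM => //.
Qed.

Let likelihood_ratioE t :
  likelihood_ratio n lambda t = \int[mu]_u (integrand (t, u))%:E.
Proof.
rewrite /likelihood_ratio integral_mkcond; apply: eq_integral => u _.
rewrite patchE /integrand/= /power_weight mem_setE/= in_itv/= andbT.
by case: ifPn => // _; rewrite !mul0r.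
Qed.

Lemma likelihood_ratio_ge0 t : 0 <= likelihood_ratio n lambda t.
Proof.
by rewrite likelihood_ratioE; apply: integral_ge0 => u _; rewrite lee_fin.
Qed.

Lemma likelihood_ratio_noninc (t1 t2 : R) : (t1 <= t2)%R ->
  likelihood_ratio n lambda t2 <= likelihood_ratio n lambda t1.
Proof.
move=> t12; rewrite !likelihood_ratioE; apply: ge0_le_integral => //.
- by move=> u _; rewrite lee_fin.
- by apply/measurable_EFinP; exact: (measurableT_comp measurable_integrand).
- by apply/measurable_EFinP; exact: (measurableT_comp measurable_integrand).
- move=> u _; rewrite lee_fin /integrand/=; have [u0|u0] := leP u 0%R.
    by rewrite /power_weight ltNge u0 !mul0r.
  rewrite ler_wpM2l//.
    rewrite mulr_ge0 ?power_weight_ge0// exprn_ge0//.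
    by rewrite divr_ge0 ?sqr_ge0// ltW.
  by rewrite ler_expR lerN2 ler_pM2r ?invr_gt0// ler_pM2l// ler_wpM2l.
Qed.

Lemma measurable_likelihood_ratio :
  measurable_fun setT (likelihood_ratio n lambda).
Proof.
have mstd : measurable_fun setT (fun z : R * measurableTypeR R => (z.1, z.2) : R * R).
  apply: measurable_fun_pair; first exact: measurable_fst.
  exact: (measurableT_comp (@measurable_idR R) measurable_snd).
rewrite (_ : likelihood_ratio n lambda =
    fubini_F mu (fun z : R * measurableTypeR R => (integrand (z.1, z.2))%:E)).
  apply: measurable_fun_fubini_tonelli_F => [|z]; last by rewrite lee_fin.
  by apply/measurable_EFinP; exact: (measurableT_comp measurable_integrand mstd).
by apply/funext => t; rewrite likelihood_ratioE.
Qed.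

End likelihood_ratio_theory.

(** * The Neyman-Pearson comparison *)

Section neyman_pearson.
Local Open Scope ereal_scope.
Context (R : realType) (n : nat) d (T : measurableType d).
Variables (X : 'I_n -> {mfun T >-> R}).
Hypotheses (n_gt0 : (0 < n)%N) (X_ge0 : forall i w, (0 <= X i w)%R).
Local Notation S := (sample X).

Let S_ge0 w : nonneg_samples (S w).
Proof. by move=> i; rewrite tnth_mktuple. Qed.

Let measurable_sample_max_eq0 : measurable [set w | sample_max (S w) = 0%R].
Proof.
have := measurableT_comp (@measurable_sample_max R n) (measurable_sample X)
  measurableT (measurable_set1 0%R).
by rewrite setTI.
Qed.

(** The first coordinate already vanishes with probability 0. *)
Lemma sample_max_null (P : probability T R) (law : set R -> \bar R) :
  iid X P law -> law [set 0%R] = 0 -> P [set w | sample_max (S w) = 0%R] = 0.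
Proof.
move=> [_ lawX] law0; pose i0 := Ordinal n_gt0.
apply: (subset_measure0 (B := X i0 @^-1` [set 0%R])).
- exact: measurable_sample_max_eq0.
- by rewrite -[X in measurable X]setTI; exact: measurable_funP.
- move=> w /= M0; apply/eqP; rewrite eq_le X_ge0 andbT.
  have := (sample_max_le (S w) (lexx 0%R)).1; rewrite M0 lexx => /(_ isT i0).
  by rewrite tnth_mktuple.
- by have := lawX i0 [set 0%R] (measurable_set1 _); rewrite law0.
Qed.

Lemma sample_max_null_uniform (P : probability T R) (theta : R)
    (theta0 : (0 < theta)%R) : iid X P (uniform_prob theta0) ->
  P [set w | sample_max (S w) = 0%R] = 0.
Proof. by move/sample_max_null; apply; exact: integral_set1. Qed.

Lemma sample_max_null_exponential (P : probability T R) (lambda : R) :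
  iid X P (exponential_prob lambda) ->
  P [set w | sample_max (S w) = 0%R] = 0.
Proof. by move/sample_max_null; apply; exact: integral_set1. Qed.

Lemma measurable_rejection (Phi : n.-tuple R -> bool) : is_test Phi ->
  measurable [set w | Phi (S w)].
Proof.
move=> mPhi.
have mN : measurable (nonneg_samples `&` Phi @^-1` [set true]).
  by apply: mPhi => //; exact: measurable_nonneg_samples.
have := measurable_sample X measurableT mN; rewrite setTI.
congr (measurable _); apply/seteqP; split => w /=; first by case.
by split => //; exact: S_ge0.
Qed.

(** The uniform sample on [0, s * theta] is s times the uniform sample on
    [0, theta], and a scale-free test does not see the factor s. *)
Lemma rejection_probability_uniform_scale (P0 P : probability T R) (theta s : R)
    (theta0 : (0 < theta)%R) (stheta0 : (0 < s * theta)%R)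
    (Phi : n.-tuple R -> bool) :
  scale_free_test Phi ->
  iid X P0 (uniform_prob theta0) -> iid X P (uniform_prob stheta0) ->
  rejection_probability X P Phi = rejection_probability X P0 Phi.
Proof.
move=> [mPhi sPhi] iid0 iid1.
have s0 : (0 < s)%R by rewrite -(pmulr_lgt0 _ theta0).
pose E : set (n.-tuple R) := nonneg_samples `&` Phi @^-1` [set true].
have mE : measurable E.
  by apply: mPhi => //; exact: measurable_nonneg_samples.
have mR := measurable_rejection mPhi.
pose U := default_measure (uniform_prob theta0).
pose V := default_measure (uniform_prob stheta0).
have UP A : measurable A ->
    \int[U]_x (\1_A (s * x) * 1)%:E = \int[V]_x (\1_A x * 1)%:E.
  move=> mA; under eq_integral do rewrite mulr1.
  under [RHS]eq_integral do rewrite mulr1.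
  rewrite integral_default_measure.
  - by rewrite uniform_prob_scale// integral_indic// setIT.
  - apply/measurable_EFinP.
    exact: (measurableT_comp (measurable_indic mA) (mulrl_measurable _)).
  - by move=> x; rewrite lee_fin indicE.
have U1 : \int[U]_x (1%R)%:E < +oo.
  rewrite -[X in X < _]/(\int[U]_x (cst 1 x)) integral_cst// mul1e.
  by rewrite -[X in X < _]/(uniform_prob theta0 setT) probability_setT ltry.
have H := ge0_integral_iid_change (U := U) (V := V) (g := fun=> 1%R)
  (k := fun=> 1%R) (h := EFin \o \1_E)
  iid0 iid1 (mulrl_measurable s) (@measurable_id _ _ setT)
  (measurable_cst _) (fun=> ler01) (measurable_cst _) (fun=> ler01) U1 UP.
have E0 w : \1_E (S w) = \1_[set w | Phi (S w)] w :> R.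
  rewrite !indicE; congr (nat_of_bool _)%:R.
  apply/idP/idP; rewrite !in_setE; first by case.
  by split => //; exact: S_ge0.
have Es w : \1_E [tuple (s * X i w)%R | i < n] = \1_[set w | Phi (S w)] w :> R.
  rewrite -E0 !indicE; congr (nat_of_bool _)%:R.
  rewrite (_ : [tuple _ | _ < _] = scale_sample s (S w)); last first.
    by apply: eq_from_tnth => i; rewrite !tnth_mktuple.
  apply/idP/idP; rewrite !in_setE => -[_ /= h].
    split; first exact: S_ge0.
    by rewrite /= -(sPhi _ _ s0 (S_ge0 w)).
  split; first by apply: nonneg_samples_scale => //; exact: S_ge0.
  by rewrite /= (sPhi _ _ s0 (S_ge0 w)).
have intP (Q : probability T R) : rejection_probability X Q Phi =
    \int[Q]_w (\1_[set w | Phi (S w)] w)%:E.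
  by rewrite integral_indic// setIT.
rewrite !intP; apply/esym.
transitivity (\int[P0]_w ((EFin \o \1_E) [tuple (s * X i w)%R | i < n] *
    (\prod_(i < n) 1)%:E)).
  by apply: eq_integral => w _; rewrite big1// mule1/= Es.
rewrite H//.
- by apply: eq_integral => w _; rewrite big1// mule1/= E0.
- by apply/measurable_EFinP; exact: measurable_indic.
- by move=> x; rewrite lee_fin indicE.
Qed.

Variables (P0 P1 : probability T R) (theta lambda : R).
Hypotheses (theta0 : (0 < theta)%R) (lambda0 : (0 < lambda)%R).
Hypotheses (iid0 : iid X P0 (uniform_prob theta0))
  (iid1 : iid X P1 (exponential_prob lambda)).

(** Samples with maximum 0 are discarded from the second event only, which is
    the one whose probability has to be computed from the likelihood ratio. *)
Let rejection_split (P : probability T R) (Phi Psi : n.-tuple R -> bool) :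
  is_test Phi -> is_test Psi -> P [set w | sample_max (S w) = 0%R] = 0 ->
  rejection_probability X P Phi =
  P [set w | Phi (S w) && Psi (S w)] +
  P [set w | [/\ Phi (S w), ~~ Psi (S w) & (0 < sample_max (S w))%R]].
Proof.
move=> /measurable_rejection mPhi /measurable_rejection mPsi null.
have mM : measurable [set w | sample_max (S w) = 0%R].
  exact: measurable_sample_max_eq0.
rewrite /rejection_probability (measureDI P mPhi mPsi) addeC; congr (_ + _).
  by congr (P _); apply/seteqP; split => w /andP.
have mD := measurableD mPhi mPsi.
rewrite (measureDI P mD mM) [X in _ + X](_ : _ = 0) ?adde0; last first.
  apply: (subset_measure0 (measurableI _ _ mD mM) mM _ null).
  exact: subIsetr.
congr (P _); apply/seteqP; split => w /=.
  move=> [[Pw /negP Qw] /eqP M0]; split => //.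
  by rewrite lt_neqAle eq_sym M0 sample_max_ge0.
move=> [Pw /negP Qw M0]; split => //.
by move=> Me; move: M0; rewrite Me ltxx.
Qed.

(** The event that only one of two scale-free tests rejects is a cone. *)
Let event_probability (Phi Psi : n.-tuple R -> bool) :
  let D := [set w | [/\ Phi (S w), ~~ Psi (S w) & (0 < sample_max (S w))%R]] in
  scale_free_test Phi -> scale_free_test Psi ->
  measurable D /\
  P1 D = \int[P0]_(w in D) likelihood_ratio n lambda (mean_max (S w)).
Proof.
move=> D [mPhi sPhi] [mPsi sPsi].
pose E : set (n.-tuple R) := (nonneg_samples `&` Phi @^-1` [set true]) `&`
  (nonneg_samples `&` Psi @^-1` [set false]) `&` [set x | (0 < sample_max x)%R].
have mE : measurable E.
  apply: measurableI; first apply: measurableI.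
  - by apply: mPhi => //; exact: measurable_nonneg_samples.
  - by apply: mPsi => //; exact: measurable_nonneg_samples.
  - rewrite -[X in measurable X]setTI.
    rewrite (_ : [set x | _] = @sample_max R n @^-1` `]0%R, +oo[).
      by apply: measurable_sample_max => //; exact: measurable_itv.
    by apply/seteqP; split => x /=; rewrite in_itv/= andbT.
have E_cone t x : (0 < t)%R -> nonneg_samples x -> E (scale_sample t x) <-> E x.
  move=> t0 x0; have tx0 := nonneg_samples_scale t0 x0.
  rewrite /E /= sPhi// sPsi// sample_max_scale// pmulr_rgt0//.
  by split=> -[[[_ a] [_ b]] c].
have DE : D = [set w | E (S w)].
  apply/seteqP; split => w.
    move=> [a /negbTE b c]; split; last exact: c.
    by split; split; rewrite /= ?a ?b//; exact: S_ge0.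
  case=> -[[_ a] [_ b]] c; split; [exact: a|by rewrite b|exact: c].
split; rewrite DE.
  by rewrite -[X in measurable X]setTI; exact: measurable_sample.
apply: (exponential_probability_cone n_gt0 X_ge0 lambda0 iid0 iid1) => //.
by move=> x [].
Qed.

(** Let A be the event that only Phi rejects and B the event that only the
    mean/max test does.  Below, L is the likelihood ratio at c; on A it bounds
    the density from above, on B from below, so
    P1 A <= L * P0 A <= L * P0 B <= P1 B, where the middle step is the hypothesis
    on the levels. *)
Lemma mean_max_test_most_powerful (c : R) (Phi : n.-tuple R -> bool) :
  scale_free_test Phi ->
  rejection_probability X P0 Phi <= rejection_probability X P0 (mean_max_test c) ->
  rejection_probability X P1 Phi <= rejection_probability X P1 (mean_max_test c).
Proof.
move=> sPhi; have sc := @scale_free_mean_max_test R n c.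
have null0 := sample_max_null_uniform iid0.
have null1 := sample_max_null_exponential iid1.
pose ratio w := likelihood_ratio n lambda (mean_max (S w)).
have mratio : measurable_fun setT ratio.
  apply: (measurableT_comp (measurable_likelihood_ratio n lambda0)).
  exact: (measurableT_comp (@measurable_mean_max R n) (measurable_sample X)).
have [mA PA] := event_probability sPhi sc.
have [mB PB] := event_probability sc sPhi.
rewrite (rejection_split sPhi.1 sc.1 null0) (rejection_split sPhi.1 sc.1 null1).
rewrite (rejection_split sc.1 sPhi.1 null0) (rejection_split sc.1 sPhi.1 null1).
under [X in _ <= P0 X + _]eq_set do rewrite andbC.
under [X in _ -> _ <= P1 X + _]eq_set do rewrite andbC.
have mC : measurable [set w | Phi (S w) && mean_max_test c (S w)].
  rewrite (_ : mkset _ = [set w | Phi (S w)] `&` [set w | mean_max_test c (S w)]).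
    by apply: measurableI; apply: measurable_rejection; [exact: sPhi.1|exact: sc.1].
  by apply/seteqP; split => w /=; [move/andP|move=> [-> ->]].
rewrite leeD2lE ?fin_num_measure// => AB0; rewrite leeD2lE ?fin_num_measure//.
rewrite PA PB.
set A := mkset _ in mA PA AB0 *; set B := (X in P0 A <= P0 X) in mB PB AB0 *.
apply: (@le_trans _ _ (likelihood_ratio n lambda c * P0 A)).
  have <- : \int[P0]_(_ in A) likelihood_ratio n lambda c =
      likelihood_ratio n lambda c * P0 A by exact: integral_cst.
  apply: ge0_le_integral => //.
  - by move=> w _; exact: likelihood_ratio_ge0.
  - exact: measurable_funTS.
  - move=> w [_ + _]; rewrite -ltNge => cw.
    by apply: likelihood_ratio_noninc => //; exact: ltW.
apply: (@le_trans _ _ (likelihood_ratio n lambda c * P0 B)).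
  by apply: lee_wpmul2l => //; exact: likelihood_ratio_ge0.
have <- : \int[P0]_(_ in B) likelihood_ratio n lambda c =
    likelihood_ratio n lambda c * P0 B by exact: integral_cst.
apply: ge0_le_integral => //.
- by move=> w _; exact: likelihood_ratio_ge0.
- exact: measurable_funTS.
- by move=> w [cw _ _]; exact: likelihood_ratio_noninc.
Qed.

End neyman_pearson.

(** * Optimality of the mean/max test *)

Theorem theorem2p1 (R : realType) (n : nat) (n_gt0 : (0 < n)%N)
    (d : measure_display) (T : measurableType d) (X : 'I_n -> {mfun T >-> R})
    (X_ge0 : forall i w, 0 <= X i w)
    (alpha c : R) (alpha01 : 0 < alpha < 1)
    (P0 : probability T R) (P0_H0 : under_H0 X P0)
    (c_alpha : P0 [set w | mean_max (sample X w) <= c] = alpha%:E) :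
  [/\ scale_free_test (mean_max_test c : n.-tuple R -> bool),
      forall P : probability T R, under_H0 X P ->
        rejection_probability X P (mean_max_test c) = alpha%:E
    & forall Phi' : n.-tuple R -> bool, scale_free_test Phi' ->
        (rejection_probability X P0 Phi' <= alpha%:E)%E ->
        forall P1 : probability T R, under_H1 X P1 ->
        (rejection_probability X P1 Phi' <=
         rejection_probability X P1 (mean_max_test c))%E].
Proof.
have [theta [theta0 iid0]] := P0_H0.
have sc := @scale_free_mean_max_test R n c.
split=> //.
- move=> P [theta' [theta'0 iidP]]; rewrite -c_alpha.
  have : theta' = theta' / theta * theta by rewrite divfK// gt_eqF.
  move: (theta' / theta) => s theta'E; subst theta'.
  exact: (rejection_probability_uniform_scale X_ge0 sc iid0 iidP).
- move=> Phi' sPhi' level P1 [lambda lambda0 iid1].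
  apply: (mean_max_test_most_powerful n_gt0 X_ge0 lambda0 iid0 iid1) => //.
  by rewrite /rejection_probability /mean_max_test c_alpha.
Qed.
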